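(* Let $n,r,s$ be positive integers and let $W_n$ be the Horadam quaternions built from the Horadam sequence $w_n=w_n(w_0,w_1;p,q)$. Then $$W_{n+r}W_{n+s}-W_{n}W_{n+r+s}=(-q)^{n}u_{r}\left(U_{1}U_{s}-U_{0}U_{s+1}\right)\left(w_1^2-pw_0w_1-qw_0^2\right).$$
   Context: Let $H$ be the real quaternion algebra with basis $1,i,j,k$ and (non-commutative) multiplication determined by $i^2=j^2=k^2=-1$, $ij=-ji=k$, $jk=-kj=i$, $ki=-ik=j$; real scalars commute with all quaternions. Fix real numbers $p,q$. The Horadam sequence $w_n=w_n(w_0,w_1;p,q)$ has real initial values $w_0,w_1$ and satisfies $w_n=pw_{n-1}+qw_{n-2}$ for $n\ge 2$. Let $u_n=w_n(0,1;p,q)$ (the $(p,q)$-Fibonacci numbers). The Horadam quaternions are $W_n=w_n+w_{n+1}i+w_{n+2}j+w_{n+3}k$, and the $(p,q)$-Fibonacci quaternions are $U_n=u_n+u_{n+1}i+u_{n+2}j+u_{n+3}k$. *)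

(* Defs.v *)
From HB Require Import structures.
From mathcomp Require Import all_boot all_order all_algebra.
From mathcomp Require Import reals.
From mathcomp Require Import ring.

Set Implicit Arguments.
Unset Strict Implicit.
Unset Printing Implicit Defensive.

Import GRing.Theory.
Local Open Scope ring_scope.

(* [Quat a b c d] stands for a + b i + c j + d k. *)
Record quat (R : Type) : Type := Quat { qre : R; qim : R; qjm : R; qkm : R }.

Section QuatChoice.
Variable R : Type.

Definition tuple_of_quat (x : quat R) : R * R * R * R :=
  (qre x, qim x, qjm x, qkm x).
Definition quat_of_tuple (t : R * R * R * R) : quat R :=
  let: (a, b, c, d) := t in Quat a b c d.

Lemma tuple_of_quatK : cancel tuple_of_quat quat_of_tuple.
Proof. by case. Qed.

End QuatChoice.

HB.instance Definition _ (R : eqType) :=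
  Equality.copy (quat R) (can_type (@tuple_of_quatK R)).
HB.instance Definition _ (R : choiceType) :=
  Choice.copy (quat R) (can_type (@tuple_of_quatK R)).

Section QuatAlgebra.
Variable R : realType.
Implicit Types x y z : quat R.

Definition addq x y : quat R :=
  Quat (qre x + qre y) (qim x + qim y) (qjm x + qjm y) (qkm x + qkm y).
Definition oppq x : quat R := Quat (- qre x) (- qim x) (- qjm x) (- qkm x).
Definition zeroq : quat R := Quat 0 0 0 0.
Definition oneq : quat R := Quat 1 0 0 0.
Definition scaleq (a : R) x : quat R :=
  Quat (a * qre x) (a * qim x) (a * qjm x) (a * qkm x).

(* The bilinear extension of the multiplication table of 1, i, j, k; the table
   itself is checked in the lemmas [quat_ii], ..., [quat_ik] below. *)
Definition mulq x y : quat R :=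
  let: Quat a1 b1 c1 d1 := x in
  let: Quat a2 b2 c2 d2 := y in
  Quat (a1 * a2 - b1 * b2 - c1 * c2 - d1 * d2)
       (a1 * b2 + b1 * a2 + c1 * d2 - d1 * c2)
       (a1 * c2 - b1 * d2 + c1 * a2 + d1 * b2)
       (a1 * d2 + b1 * c2 - c1 * b2 + d1 * a2).

Lemma addqA : associative addq.
Proof. by move=> [????] [????] [????]; rewrite /addq /= !addrA. Qed.
Lemma addqC : commutative addq.
Proof. by move=> [????] [????]; congr Quat; rewrite /= addrC. Qed.
Lemma add0q : left_id zeroq addq.
Proof. by move=> [????]; congr Quat; rewrite /= add0r. Qed.
Lemma addNq : left_inverse zeroq oppq addq.
Proof. by move=> [????]; congr Quat; rewrite /= addNr. Qed.

HB.instance Definition _ :=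
  GRing.isZmodule.Build (quat R) addqA addqC add0q addNq.

Lemma mulqA : associative mulq.
Proof. by move=> [????] [????] [????]; congr Quat; ring. Qed.
Lemma mul1q : left_id oneq mulq.
Proof. by move=> [????]; congr Quat; ring. Qed.
Lemma mulq1 : right_id oneq mulq.
Proof. by move=> [????]; congr Quat; ring. Qed.
Lemma mulqDl : left_distributive mulq addq.
Proof. by move=> [????] [????] [????]; congr Quat => /=; ring. Qed.
Lemma mulqDr : right_distributive mulq addq.
Proof. by move=> [????] [????] [????]; congr Quat => /=; ring. Qed.
Lemma oneq_neq0 : oneq != 0.
Proof. by apply/eqP => -[/eqP]; rewrite oner_eq0. Qed.

HB.instance Definition _ := GRing.Zmodule_isNzRing.Build (quat R)
  mulqA mul1q mulq1 mulqDl mulqDr oneq_neq0.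

Lemma scaleqA a b x : scaleq a (scaleq b x) = scaleq (a * b) x.
Proof. by case: x => ????; congr Quat; rewrite /= mulrA. Qed.
Lemma scale1q : left_id 1 scaleq.
Proof. by move=> [????]; congr Quat; rewrite /= mul1r. Qed.
Lemma scaleqDr : right_distributive scaleq +%R.
Proof. by move=> ? [????] [????]; congr Quat; rewrite /= mulrDr. Qed.
Lemma scaleqDl x : {morph scaleq^~ x : a b / a + b}.
Proof. by case: x => ???? a b; congr Quat; rewrite /= mulrDl. Qed.

HB.instance Definition _ := GRing.Zmodule_isLmodule.Build R (quat R)
  scaleqA scale1q scaleqDr scaleqDl.

Lemma scaleqAl (a : R) x y : a *: (x * y) = (a *: x) * y.
Proof. by case: x y => ???? [????]; congr Quat => /=; ring. Qed.

HB.instance Definition _ := GRing.Lmodule_isLalgebra.Build R (quat R) scaleqAl.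

Lemma scaleqAr (a : R) x y : a *: (x * y) = x * (a *: y).
Proof. by case: x y => ???? [????]; congr Quat => /=; ring. Qed.

HB.instance Definition _ := GRing.Lalgebra_isAlgebra.Build R (quat R) scaleqAr.

Definition iq : quat R := Quat 0 1 0 0.
Definition jq : quat R := Quat 0 0 1 0.
Definition kq : quat R := Quat 0 0 0 1.

Lemma quat_ii : iq * iq = -1. Proof. by congr Quat => /=; ring. Qed.
Lemma quat_jj : jq * jq = -1. Proof. by congr Quat => /=; ring. Qed.
Lemma quat_kk : kq * kq = -1. Proof. by congr Quat => /=; ring. Qed.
Lemma quat_ij : iq * jq = kq. Proof. by congr Quat => /=; ring. Qed.
Lemma quat_ji : jq * iq = - kq. Proof. by congr Quat => /=; ring. Qed.
Lemma quat_jk : jq * kq = iq. Proof. by congr Quat => /=; ring. Qed.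
Lemma quat_kj : kq * jq = - iq. Proof. by congr Quat => /=; ring. Qed.
Lemma quat_ki : kq * iq = jq. Proof. by congr Quat => /=; ring. Qed.
Lemma quat_ik : iq * kq = - jq. Proof. by congr Quat => /=; ring. Qed.

Lemma quatE (a b c d : R) :
  Quat a b c d = a%:A + b *: iq + c *: jq + d *: kq.
Proof. by congr Quat => /=; ring. Qed.

End QuatAlgebra.

Section Horadam.
Variable R : realType.
Implicit Types p q w : R.

Fixpoint horadam w0 w1 p q (n : nat) : R :=
  match n with
  | 0 => w0
  | n'.+1 =>
    match n' with
    | 0 => w1
    | n''.+1 => p * horadam w0 w1 p q n' + q * horadam w0 w1 p q n''
    end
  end.

Definition pqfib p q (n : nat) : R := horadam 0 1 p q n.

Definition quat_of_seq (w : nat -> R) (n : nat) : quat R :=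
  (w n)%:A + w n.+1 *: iq R + w n.+2 *: jq R + w n.+3 *: kq R.

Definition horadam_quat w0 w1 p q (n : nat) : quat R :=
  quat_of_seq (horadam w0 w1 p q) n.

Definition pqfib_quat p q (n : nat) : quat R := quat_of_seq (pqfib p q) n.

End Horadam.

(* Main.v *)
(** Every sequence [X] with [X (n+2) = p X (n+1) + q X n] in an algebra satisfies
    [X (n+r) = u_r X (n+1) + q u_(r-1) X n], so the left-hand side is [u_r] times
    [D_n := W (n+1) W (n+s) - W n W (n+s+1)]: the terms in [q u_(r-1)] cancel
    because scalars are central. The recurrence gives [D_(n+1) = - q D_n], hence
    [D_n = (- q)^n D_0]. Finally, substituting [W n = (w1 - p w0) U n + w0 U (n+1)]
    in [D_0] and using [D_1 = - q D_0] for [U] produces the factor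
    [w1^2 - p w0 w1 - q w0^2]. No step permutes two quaternion factors. *)
Require Import Defs.
From HB Require Import structures.
From mathcomp Require Import all_boot all_order all_algebra.
From mathcomp Require Import reals.
From mathcomp Require Import ring.

Import GRing.Theory.
Local Open Scope ring_scope.

Definition horadam_rec (R : pzRingType) (V : lmodType R) (p q : R)
    (X : nat -> V) : Prop :=
  forall n, X n.+2 = p *: X n.+1 + q *: X n.

Section HoradamSequences.
Variables (R : realType) (p q : R).

Lemma horadam_rec_add (V : lmodType R) (X : nat -> V) :
  horadam_rec R V p q X ->
  forall n r, X (n + r.+1)%N = pqfib p q r.+1 *: X n.+1 + (q * pqfib p q r) *: X n.
Proof.
move=> recX n r; elim: r n => [|r IHr] n.
  by rewrite addn1 /pqfib /= mulr0 scale1r scale0r addr0.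
(* One step moves from [r] to [n], so the hypothesis is used at [n.+1]. *)
rewrite -addSnnS IHr recX scalerDr !scalerA addrAC -scalerDl.
by congr (_ *: _ + _ *: _); rewrite /pqfib /=; ring.
Qed.

Lemma horadam_rec_shift (A : algType R) (X : nat -> A) :
  horadam_rec R A p q X ->
  forall n r s, X (n + r.+1)%N * X (n + s)%N - X n * X (n + r.+1 + s)%N =
    pqfib p q r.+1 *: (X n.+1 * X (n + s)%N - X n * X (n + s).+1).
Proof.
move=> recX n r s; have addX := horadam_rec_add A X recX.
rewrite addnAC (addX n r) (addX (n + s)%N r) mulrDl mulrDr.
by rewrite -!scalerAl -!scalerAr opprD addrACA subrr addr0 scalerBr.
Qed.

(** Both sides obey the recurrence and agree at 0 and 1, as u_0 = 0, u_1 = 1, u_2 = p. *)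
Lemma horadam_pqfib (w0 w1 : R) n :
  horadam w0 w1 p q n =
    (w1 - p * w0) * pqfib p q n + w0 * pqfib p q n.+1.
Proof.
suff: horadam w0 w1 p q n =
        (w1 - p * w0) * pqfib p q n + w0 * pqfib p q n.+1 /\
      horadam w0 w1 p q n.+1 =
        (w1 - p * w0) * pqfib p q n.+1 + w0 * pqfib p q n.+2 by case.
elim: n => [|n [IH0 IH1]]; first by split; rewrite /pqfib /=; ring.
split=> //; rewrite [LHS]/= -/(horadam w0 w1 p q n.+1) IH1 IH0.
by rewrite /pqfib /=; ring.
Qed.

End HoradamSequences.

Section HoradamQuaternions.
Variables (R : realType) (p q : R).

Lemma horadam_quat_rec w0 w1 :
  horadam_rec R (quat R) p q (horadam_quat w0 w1 p q).
Proof.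
by move=> n; rewrite /horadam_quat /quat_of_seq -!quatE; congr Quat.
Qed.

Lemma horadam_quat_pqfib w0 w1 n :
  horadam_quat w0 w1 p q n =
    (w1 - p * w0) *: pqfib_quat p q n + w0 *: pqfib_quat p q n.+1.
Proof.
rewrite /horadam_quat /pqfib_quat /quat_of_seq -!quatE.
by congr Quat; exact: horadam_pqfib.
Qed.

Lemma horadam_rec_cassini (X : nat -> quat R) : horadam_rec R (quat R) p q X ->
  forall n s, X n.+1 * X (n + s)%N - X n * X (n + s).+1 =
    (- q) ^+ n *: (X 1%N * X s - X 0%N * X s.+1).
Proof.
move=> recX n s; elim: n => [|n IHn]; first by rewrite expr0 scale1r.
rewrite exprS -scalerA -IHn addSn !recX.
(* The [p] terms cancel, so the identity holds for any four quaternions. *)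
move: (X n) (X n.+1) (X (n + s)%N) (X (n + s).+1) => [????] [????] [????] [????].
by congr Quat => /=; ring.
Qed.

Lemma horadam_quat_cassini0 w0 w1 s :
  let W := horadam_quat w0 w1 p q in
  let U := pqfib_quat p q in
  W 1%N * W s - W 0%N * W s.+1 =
    (w1 ^+ 2 - p * w0 * w1 - q * w0 ^+ 2) *: (U 1%N * U s - U 0%N * U s.+1).
Proof.
have recU : horadam_rec R (quat R) p q (pqfib_quat p q).
  exact: horadam_quat_rec.
(* Everything is now in U_0, U_1, U_s, U_(s+1). With a = w1 - p w0, the factor arises as a^2 + p a
   w0 - q w0^2. *)
rewrite /= !horadam_quat_pqfib !recU.
move: (pqfib_quat p q 0) (pqfib_quat p q 1) => [????] [????].
move: (pqfib_quat p q s) (pqfib_quat p q s.+1) => [????] [????].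
by congr Quat => /=; ring.
Qed.

End HoradamQuaternions.

Theorem theorem2p4 (R : realType) (p q w0 w1 : R) (n r s : nat)
    (hn : (0 < n)%N) (hr : (0 < r)%N) (hs : (0 < s)%N) :
  let W := horadam_quat w0 w1 p q in
  let u := pqfib p q in
  let U := pqfib_quat p q in
  W (n + r)%N * W (n + s)%N - W n * W (n + r + s)%N =
  ((- q) ^+ n * u r) *: (U 1%N * U s - U 0%N * U s.+1)
    * (w1 ^+ 2 - p * w0 * w1 - q * w0 ^+ 2)%:A.
Proof.
case: r hr => // r _ W u U.
have recW : horadam_rec R (quat R) p q W by exact: horadam_quat_rec.
rewrite (horadam_rec_shift _ _ _ _ _ recW) -/u.
rewrite (horadam_rec_cassini _ _ _ _ recW) horadam_quat_cassini0 -/U.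
(* The right-hand factor is a real multiple of 1, hence a scalar. *)
by rewrite -scalerAr mulr1 !scalerA; congr (_ *: _); ring.
Qed.
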